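(* Let $n$ be a positive integer, let $a \in \{1, \ldots, 2^n-1\}$, and let $k$ be the unique integer satisfying $2^n - 2^k \le a < 2^n - 2^{k-1}$. Let $A_a \subseteq \mathbb{Z}_2^n$ be the set of vectors in $\{0,1\}^n$ that are the binary representations of the numbers $2^n-1, \ldots, 2^n-a$. Then an $a$-element set $A \subseteq \mathbb{Z}_2^n$ satisfies $\mathrm{ST}(A) = \mathrm{ST}(A_a)$ if and only if there is a subgroup $K \le \mathbb{Z}_2^n$ with $2^k$ elements such that $\mathbb{Z}_2^n \setminus K \subseteq A$ and $A \cap K$ is sum-free.
   Context: For a subset $A$ of a finite abelian group, $\mathrm{ST}(A) = |\{(x,y,z) \in A^3 : x+y=z\}|$ is the number of (ordered) Schur triples contained in $A$ (elements not necessarily distinct). A set is sum-free if it contains no $x,y,z$ (not necessarily distinct) with $x+y=z$. Elements of $\mathbb{Z}_2^n$ are identified with $\{0,1\}$-vectors of length $n$, and an integer in $\{0,\ldots,2^n-1\}$ with its $n$-digit binary representation. The integer $k$ may be $0$, in which case $2^{k-1} = 1/2$. *)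

(* Defs.v *)
From HB Require Import structures.
From mathcomp Require Import all_boot all_order all_algebra all_fingroup.

Set Implicit Arguments.
Unset Strict Implicit.
Unset Printing Implicit Defensive.

Import Order.TTheory GRing.Theory Num.Theory.
Local Open Scope ring_scope.

Definition ST (G : finZmodType) (A : {set G}) : nat :=
  #|[set t : G * G * G |
      [&& t.1.1 \in A, t.1.2 \in A, t.2 \in A & t.1.1 + t.1.2 == t.2]]|.

Definition sum_free (G : finZmodType) (A : {set G}) : Prop :=
  forall x y z : G, x \in A -> y \in A -> z \in A -> x + y <> z.

(* Column i holds the digit of weight 2 ^ (n - 1 - i), so the most significant
   digit comes first. *)
Definition binary_rep (n m : nat) : 'rV['F_2]_n :=
  \row_(i < n) ((m %/ 2 ^ (n - i.+1)) %% 2)%N%:R.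

(* The binary representations of 2 ^ n - 1, ..., 2 ^ n - a. *)
Definition top_set (n a : nat) : {set 'rV['F_2]_n} :=
  [set binary_rep n m | m : 'I_(2 ^ n) & (2 ^ n - a <= m)%N].

(* Main.v *)
Require Import Defs.
From HB Require Import structures.
From mathcomp Require Import all_boot all_order all_algebra all_fingroup.
From mathcomp Require Import pgroup sylow.
From mathcomp Require Import zify ring lra.

Set Implicit Arguments.
Unset Strict Implicit.
Unset Printing Implicit Defensive.

Import Order.TTheory GRing.Theory Num.Theory.
Local Open Scope ring_scope.

(** Let B be the complement of A, let b = #|B| and t = 2 ^ k, so that
    t / 2 < b <= t.  Expanding indicator functions shows that ST A + ST B
    depends only on n and b, so ST A is minimal when ST B is maximal.  The same
    expansion inside a subgroup K of order t that contains B gives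
      ST B + ST (K :\: B) = t^2 - 3tb + 3b^2                ([ST_compl]),
    hence ST B = t^2 - 3tb + 3b^2 exactly when K :\: B, which is A :&: K, is
    sum-free.  The complement of [top_set n a] is the initial segment [0, b) of
    the binary numbers; it lies in the subgroup [0, t), and the numbers in
    [b, t) share their top digit, so they form a sum-free set ([ST_low_set]).

    What remains is [ST_max]: every set of b <= t elements satisfies
    ST B <= t^2 - 3tb + 3b^2, and if b > t / 2, then equality forces B into a
    subgroup of order t.  The proof is by induction.  If 2b <= t, the bound for
    t / 2 is the stronger one.  If B spans a space of order at most t, then
    [ST_compl] applies to a subgroup of order t containing B.  Otherwise each
    linear form v that does not vanish on B cuts B into B0 (where v = 0) and a
    nonempty B1 (where v = 1), of sizes b0 and b1.  A Schur triple has zero or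
    two elements in B1, whence ST B <= ST B0 + 3 b1^2.
    - If 2 b0 >= t, the induction hypothesis for (B0, t) gives the bound;
      equality can hold only if 2 b0 = t, in which case B0 is a subgroup and B1
      lies in a single coset of it.
    - If 2 b0 < t and 4 b1 < t, the induction hypothesis for (B0, t / 2) gives
      a strict bound.
    - If neither case occurs for any v, then every Fourier coefficient
      b0 - b1 of B at such a v is less than t / 4, and the identities
      2^n ST B = sum of the cubes and 2^n b = sum of the squares of the
      coefficients give a strict bound ([ST_fourier]). *)

(** * Inequalities for the quadratic t^2 - 3tb + 3b^2 *)

(** The difference of the two bounds is 3t(t - b). *)
Lemma quad_double (s t b : nat) : (b <= t)%N ->
  (s + 3 * t * b <= t ^ 2 + 3 * b ^ 2)%N ->
  (s + 3 * (2 * t) * b <= (2 * t) ^ 2 + 3 * b ^ 2)%N.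
Proof. rewrite -!mulnn => bt; have := leq_mul bt (leqnn t); lia. Qed.

(** With parts of sizes b and c and the bound for t on the first part, the
    slack in the bound for 2t is at least 3(t - b)(t - 2c). *)
Lemma quad_small_half (s r t b c : nat) :
  (b < t)%N -> (2 * c < t)%N -> (r <= c * c)%N ->
  (s + 3 * t * b <= t ^ 2 + 3 * b ^ 2)%N ->
  (s + 3 * r + 3 * (2 * t) * (b + c) < (2 * t) ^ 2 + 3 * (b + c) ^ 2)%N.
Proof.
rewrite -!mulnn => bt ct rc le.
have [p tE] : exists p, t = (2 * c + p.+1)%N by exists (t - (2 * c).+1)%N; lia.
have := leq_mul bt (leqnn p.+1); subst t; lia.
Qed.

(** Here the bound for t is used on both sides, and the slack is at least
    3c(2b - t). *)
Lemma quad_large_half (s r t b c : nat) : (t <= 2 * b)%N -> (r <= c * c)%N ->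
  (s + 3 * t * b <= t ^ 2 + 3 * b ^ 2)%N ->
  (s + 3 * r + 3 * t * (b + c) <= t ^ 2 + 3 * (b + c) ^ 2)%N.
Proof.
by rewrite -!mulnn => tb rc le; have := leq_mul tb (leqnn c); lia.
Qed.

Lemma quad_large_half_eq (s r t b c : nat) : (t <= 2 * b)%N -> (r <= c * c)%N ->
  (0 < c)%N -> (s + 3 * t * b <= t ^ 2 + 3 * b ^ 2)%N ->
  (s + 3 * r + 3 * t * (b + c) = t ^ 2 + 3 * (b + c) ^ 2)%N ->
  [/\ t = (2 * b)%N, r = (c * c)%N & s = (b * b)%N].
Proof.
rewrite -!mulnn => tb rc c0 le e.
have tE : t = (2 * b)%N.
  apply/eqP; rewrite eqn_leq tb /= leqNgt; apply/negP => lt.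
  by have := leq_mul lt (leqnn c); lia.
by subst t; split=> //; lia.
Qed.

(** After multiplication by 8tN, the contrary assumption contradicts the
    positivity of 8t^3 - 26t^2b + 25tb^2 - 4b^3 for t/2 < b <= t. *)
Lemma fourier_arith (t b N w S : int) : t < 2 * b -> b <= t -> 0 < N ->
  2 * t * w <= N -> 4 * (N * S) <= 4 * w * b ^+ 3 + t * (N * b - w * b ^+ 2) ->
  S + 3 * t * b < t ^+ 2 + 3 * b ^+ 2.
Proof.
move=> tb bt N0 wN le; rewrite ltNge; apply/negP => ge.
have t0 : 0 < t by lia.
have b0 : 0 < b by lia.
(* Twice the cubic, split so that each summand is visibly nonnegative. *)
have pos : 0 < 4 * b * ((t - b) * (2 * b - t))
             + 2 * t * (19 * b ^+ 2 - 24 * t * b + 8 * t ^+ 2).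
  have h1 : 0 <= 4 * b * ((t - b) * (2 * b - t)) by rewrite !mulr_ge0 //; lia.
  have -> : 19 * b ^+ 2 - 24 * t * b + 8 * t ^+ 2
            = 2 * (2 * t - 3 * b) ^+ 2 + b ^+ 2 by ring.
  have h2 : 0 < 2 * t * (2 * (2 * t - 3 * b) ^+ 2 + b ^+ 2).
    by rewrite !mulr_gt0 // ltr_wpDl ?exprn_gt0 // mulr_ge0 ?sqr_ge0.
  by rewrite ltr_wpDl.
have h1 : (2 * t * w) * (b ^+ 2 * (4 * b - t)) <= N * (b ^+ 2 * (4 * b - t)).
  by rewrite ler_wpM2r // mulr_ge0 ?sqr_ge0 //; lia.
have h2 : 8 * t * N * (t ^+ 2 + 3 * b ^+ 2 - 3 * t * b) <= 8 * t * N * S.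
  by rewrite ler_wpM2l ?mulr_ge0 //; lia.
have h3 : 2 * t * (4 * (N * S)) <=
          2 * t * (4 * w * b ^+ 3 + t * (N * b - w * b ^+ 2)).
  by rewrite ler_wpM2l //; lia.
have h4 := mulr_gt0 N0 pos.
clear -h1 h2 h3 h4; lra.
Qed.

(** * Counting Schur triples in a group of exponent two *)

Lemma addrr_F2 n (x : 'rV['F_2]_n) : x + x = 0.
Proof. by apply/rowP => i; rewrite !mxE -mulr2n -mulr_natr pchar_Zp ?mulr0. Qed.

Section Triples.
Variables (G : finZmodType) (addxx : forall x : G, x + x = 0).
Implicit Types (X Y Z B H : {set G}) (K : {group G}) (x y : G).

Lemma addKr2 x y : x + (x + y) = y.
Proof. by rewrite addrA addxx add0r. Qed.

Lemma group_addr K x y : x \in K -> y \in K -> x + y \in K.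
Proof. exact: groupM. Qed.

Definition tri X Y Z : nat := (\sum_(x in X) \sum_(y in Y) ((x + y)%R \in Z))%N.

Lemma triC12 X Y Z : tri X Y Z = tri Y X Z.
Proof.
rewrite /tri exchange_big /=; apply: eq_bigr => y _; apply: eq_bigr => x _.
by rewrite addrC.
Qed.

(** In a group of exponent two, x + y = z reads x + z = y, so a Schur triple
    has no distinguished sum. *)
Lemma triC23 X Y Z : tri X Y Z = tri X Z Y.
Proof.
apply: eq_bigr => x _; rewrite big_mkcond [RHS]big_mkcond /=.
rewrite [LHS](reindex_inj (addrI x)) /=; apply: eq_bigr => y _.
by rewrite addKr2; do 2![case: (_ \in _)].
Qed.

Lemma tri_splitl (H X Y Z : {set G}) :
  tri X Y Z = (tri (X :&: H) Y Z + tri (X :\: H) Y Z)%N.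
Proof. by rewrite /tri (big_setID H). Qed.

Lemma tri_full X Y Z :
  {in X & Y, forall x y, x + y \in Z} -> tri X Y Z = (#|X| * #|Y|)%N.
Proof.
move=> XYZ; rewrite /tri -sum_nat_const; apply: eq_bigr => x Xx.
by rewrite -sum1_card; apply: eq_bigr => y Yy; rewrite XYZ.
Qed.

Lemma tri0 X Y Z :
  {in X & Y, forall x y, x + y \notin Z} -> tri X Y Z = 0%N.
Proof.
move=> XYZ; rewrite /tri big1 // => x Xx; rewrite big1 // => y Yy.
by rewrite (negPf (XYZ _ _ Xx Yy)).
Qed.

Lemma tri_le X Y Z : (tri X Y Z <= #|X| * #|Y|)%N.
Proof.
rewrite /tri -sum_nat_const; apply: leq_sum => x _.
by rewrite -sum1_card; apply: leq_sum => y _; exact: leq_b1.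
Qed.

Lemma tri_eq_full X Y Z : tri X Y Z = (#|X| * #|Y|)%N ->
  {in X & Y, forall x y, x + y \in Z}.
Proof.
move=> E x y Xx Yy; apply: contraT => nZ.
suff: (tri X Y Z < #|X| * #|Y|)%N by rewrite E ltnn.
rewrite /tri -sum_nat_const (bigD1 x) // [ltnRHS](bigD1 x) //= -addSn.
rewrite leq_add //.
  rewrite -sum1_card (bigD1 y) // [ltnRHS](bigD1 y) //= (negPf nZ).
  rewrite add0n add1n ltnS.
  by apply: leq_sum => z _; exact: leq_b1.
apply: leq_sum => z _; rewrite -sum1_card; apply: leq_sum => u _; exact: leq_b1.
Qed.

Lemma ST_tri B : ST B = tri B B B.
Proof.
rewrite /tri pair_big /= /ST.
pose P := [set p : G * G | [&& p.1 \in B, p.2 \in B & p.1 + p.2 \in B]].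
transitivity #|P|; last first.
  rewrite -sum1_card big_mkcond [RHS]big_mkcond /=; apply: eq_bigr => p _.
  by rewrite inE; do 3![case: (_ \in B)].
rewrite -(@card_imset _ _ (fun p : G * G => (p.1, p.2, p.1 + p.2)) P);
  last first.
  by move=> [x y] [x' y'] /= [-> ->].
apply: eq_card => [[[x y] z]]; rewrite inE /=; apply/idP/imsetP => /=.
  case/and4P=> Bx By Bz /eqP E; exists (x, y); rewrite ?inE /= ?E //.
  by rewrite Bx By.
by case=> [[x' y']]; rewrite inE /= => /and3P[? ? ?] [-> -> ->]; apply/and4P.
Qed.

(** Any two elements of a Schur triple determine the third, which lies in K as
    soon as they do.  So when D = K :\: B is written as K minus B in the three
    slots, every term that involves K is a product of sizes. *)
Lemma ST_compl K B : B \subset K ->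
  (ST B + ST (K :\: B) + 3 * #|K| * #|B| = #|K| ^ 2 + 3 * #|B| ^ 2)%N.
Proof.
move=> BK; set D := K :\: B.
have DK : D \subset K by exact: subsetDl.
have KB : K :&: B = B by apply/setIidPr.
have cK : #|K| = (#|B| + #|D|)%N by rewrite -(cardsID B K) KB.
have full (X Y : {set G}) :
    X \subset K -> Y \subset K -> tri K X Y = (#|X| * #|Y|)%N.
  move=> XK YK; rewrite triC12 triC23; apply: tri_full => x y Xx Yy.
  by apply: group_addr; [apply: (subsetP XK) | apply: (subsetP YK)].
have split X Y : tri K X Y = (tri B X Y + tri D X Y)%N.
  by rewrite (tri_splitl B) KB.
have := split B B; have := split D B; have := split D D.
rewrite !full // !ST_tri cK => e1 e2 e3.
have e4 : tri B D D = tri D D B by rewrite triC12 triC23.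
have e5 : tri B D B = tri D B B by rewrite triC12.
move: e1 e2 e3; rewrite -!mulnn e4 e5.
move: (tri D B B) (tri D D B) (tri D D D) (tri B B B) #|D| #|B|; clear; nia.
Qed.

(** The hypothesis says that H is a subgroup of index at most two; a Schur
    triple then has an even number of elements outside H, and two such elements
    can occupy any two of the three slots. *)
Lemma ST_split (H B : {set G}) :
  (forall x y : G, (x + y \in H) = ((x \in H) == (y \in H))) ->
  ST B = (ST (B :&: H) + 3 * tri (B :\: H) (B :\: H) (B :&: H))%N.
Proof.
move=> sumH; set B0 := B :&: H; set B1 := B :\: H.
have s1 X Y : tri B X Y = (tri B0 X Y + tri B1 X Y)%N by exact: tri_splitl.
have s2 X Y : tri X B Y = (tri X B0 Y + tri X B1 Y)%N.
  by rewrite triC12 s1 triC12 [tri B1 _ _]triC12.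
have s3 X Y : tri X Y B = (tri X Y B0 + tri X Y B1)%N.
  by rewrite triC23 s2 triC23 [tri _ B1 _]triC23.
have z0 : tri B0 B0 B1 = 0%N.
  apply: tri0 => x y; rewrite !inE => /andP[_ xH] /andP[_ yH].
  by rewrite sumH xH yH.
have z1 : tri B1 B1 B1 = 0%N.
  apply: tri0 => x y; rewrite !inE => /andP[/negPf xH _] /andP[/negPf yH _].
  by rewrite sumH xH yH.
have e1 : tri B1 B0 B0 = 0%N by rewrite triC12 triC23.
have e2 : tri B1 B0 B1 = tri B1 B1 B0 by rewrite triC23.
have e3 : tri B0 B1 B1 = tri B1 B1 B0 by rewrite triC12 e2.
have e4 : tri B0 B1 B0 = 0%N by rewrite triC23.
by rewrite !ST_tri s1 !s2 !s3 z0 z1 e1 e2 e3 e4; lia.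
Qed.

(** In exponent two, a nonempty set C closed under addition is a subgroup; K is
    the union of C and its coset y + C. *)
Lemma add_closed_coset (C : {set G}) y :
  C != set0 -> {in C &, forall x z, x + z \in C} -> y \notin C ->
  exists K : {group G}, #|K| = (2 * #|C|)%N /\
    forall x, (x \in K) = (x \in C) || (x + y \in C).
Proof.
move=> /set0Pn[c Cc] Cadd yC.
pose S := [set x | (x \in C) || (x + y \in C)].
have gS : group_set S.
  apply/group_setP; split=> [|x z].
    by rewrite inE [1%g]FinRing.Theory.zmod1gE -(addxx c) (Cadd c c).
  rewrite !inE FinRing.Theory.zmodMgE => /orP[xC|xC] /orP[zC|zC].
  - by rewrite (Cadd x z).
  - by rewrite -addrA (Cadd x (z + y)) ?orbT.
  - by rewrite addrAC (Cadd (x + y) z) ?orbT.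
  - have := Cadd _ _ xC zC; rewrite addrACA addxx addr0 => ->; exact: isT.
exists (Group gS); split=> [|x]; last by rewrite inE.
have -> : #|Group gS| = #|C :|: [set x + y | x in C]|.
  apply: eq_card => x; rewrite !inE; congr (_ || _).
  apply/idP/imsetP => [xC|[u uC ->]].
    by exists (x + y); rewrite // -addrA addxx addr0.
  by rewrite -addrA addxx addr0.
rewrite cardsU card_imset; last exact: addIr.
rewrite (_ : _ :&: _ = set0) ?cards0; first by rewrite subn0 mul2n addnn.
apply/setP => x; rewrite !inE; apply/negP => /andP[xC /imsetP[u uC xE]].
by move: yC; rewrite -(addKr2 u y) -xE Cadd.
Qed.

Lemma sum_freeP (A : {set G}) : sum_free A <-> ST A = 0%N.
Proof.
split=> [fA|/eqP].
  apply/eqP; rewrite cards_eq0; apply/eqP/setP => [[[x y] z]]; rewrite !inE /=.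
  by apply/negP => /and4P[Ax Ay Az /eqP]; apply: fA.
rewrite cards_eq0 => /eqP E x y z Ax Ay Az xyz.
have : (x, y, z) \in [set t : G * G * G |
      [&& t.1.1 \in A, t.1.2 \in A, t.2 \in A & t.1.1 + t.1.2 == t.2]].
  by rewrite inE /= Ax Ay Az xyz eqxx.
by rewrite E inE.
Qed.

End Triples.

(** * Characters and annihilators in the vector space *)

Section VectorSpace.
Variable n : nat.
Notation V := 'rV['F_2]_n.
Implicit Types (B S : {set V}) (L : {group V}) (x y v : V).

Definition dot v x : 'F_2 := \sum_i v 0 i * x 0 i.

Lemma dotC v x : dot v x = dot x v.
Proof. by apply: eq_bigr => i _; rewrite mulrC. Qed.

Lemma dotDr v x y : dot v (x + y) = dot v x + dot v y.
Proof. by rewrite -big_split; apply: eq_bigr => i _; rewrite mxE mulrDr. Qed.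

Lemma dot0r v : dot v 0 = 0.
Proof. by rewrite /dot big1 // => i _; rewrite mxE mulr0. Qed.

Definition chi v x : int := if dot v x == 0 then 1 else -1.

Lemma F2_cases (c : 'F_2) : c = 0 \/ c = 1.
Proof. by case: c => [[|[|m]] i] //; [left|right]; apply: val_inj. Qed.

Lemma chiC v x : chi v x = chi x v.
Proof. by rewrite /chi dotC. Qed.

Lemma chiD v x y : chi v (x + y) = chi v x * chi v y.
Proof.
rewrite /chi dotDr.
by case: (F2_cases (dot v x)) => ->; case: (F2_cases (dot v y)) => ->.
Qed.

(** If v is not orthogonal to some u in L, translation by u changes the sign of
    the sum. *)
Lemma chi_sum_group L v :
  \sum_(x in L) chi v x = if [forall x in L, dot v x == 0] then #|L|%:R else 0.
Proof.
case: ifPn => [/forall_inP z|].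
  rewrite -sumr_const; apply: eq_bigr => x /z; by rewrite /chi => ->.
rewrite negb_forall_in => /exists_inP[u Lu du].
have uL : u + u = 0 by exact: addrr_F2.
have E : \sum_(x in L) chi v x = - \sum_(x in L) chi v x.
  rewrite {1}(reindex_inj (addrI u)) -sumrN /=.
  apply: eq_big => [x|x _].
    apply/idP/idP => [ux|]; last exact: group_addr.
    by rewrite -[x](@addKr2 _ (@addrr_F2 n) u); apply: group_addr.
  by rewrite chiD {1}/chi (negPf du) mulN1r.
by lia.
Qed.

Definition perp S : {set V} := [set x | [forall y in S, dot x y == 0]].

Lemma perpP S x : reflect {in S, forall y, dot x y = 0} (x \in perp S).
Proof.
rewrite inE; apply: (iffP forall_inP) => H y Sy; first exact/eqP/H.
by rewrite H.
Qed.

Lemma perp_group_set S : group_set (perp S).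
Proof.
apply/group_setP; split=> [|x y /perpP xS /perpP yS].
  by apply/perpP => y _; rewrite dotC dot0r.
by apply/perpP => z Sz; rewrite [LHS]dotC dotDr ![dot z _]dotC xS ?yS ?addr0.
Qed.
Canonical perp_group S := Group (perp_group_set S).

Lemma perpT : perp [set: V] = [set 0].
Proof.
apply/setP => x; rewrite inE [RHS]inE.
apply/forall_inP/eqP => [H|-> y _]; last first.
  by rewrite dotC dot0r.
apply/rowP => i; rewrite mxE; have := H (delta_mx 0 i) (in_setT _).
rewrite /dot (bigD1 i) //= mxE !eqxx mulr1 big1 ?addr0 => [/eqP //|j /negPf nj].
by rewrite mxE eqxx nj mulr0.
Qed.

Lemma chi_sum v : \sum_x chi v x = if v == 0 then (2 ^ n)%N%:R else 0.
Proof.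
have := chi_sum_group [set: V] v.
rewrite (_ : [forall x in _, _] = (v \in perp [set: V])); last by rewrite inE.
rewrite perpT inE cardsT card_mx card_Fp // mul1n => <-.
by apply: eq_bigl => x; rewrite inE.
Qed.

(** Sum [chi v x] over v in L and all x, in both orders. *)
Lemma card_perp L : (#|L| * #|perp L| = 2 ^ n)%N.
Proof.
have : \sum_x \sum_(v in L) chi v x = (#|L| * #|perp L|)%N%:R :> int.
  under eq_bigr => x _.
    under eq_bigr => v _ do rewrite chiC.
    rewrite chi_sum_group; over.
  rewrite -big_mkcond /= sumr_const mulnC -mulrnA mulnC.
  by congr (_ *+ (_ * _)); apply: eq_card => x; rewrite inE.
rewrite exchange_big /=; under eq_bigr => v _ do rewrite chi_sum.
rewrite (bigD1 (0 : V)) ?group1 //= eqxx big1 ?addr0 ; last first.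
  by move=> v /andP[_ /negPf ->].
by move/eqP; rewrite eqr_nat => /eqP.
Qed.

Lemma mem_perp1 v x : (x \in perp [set v]) = (dot v x == 0).
Proof.
by rewrite dotC; apply/perpP/eqP => [H|H u /set1P ->] //; apply/H/set11.
Qed.

Lemma sum_mem_perp1 v x y :
  (x + y \in perp [set v]) = ((x \in perp [set v]) == (y \in perp [set v])).
Proof.
rewrite !mem_perp1 dotDr.
by case: (F2_cases (dot v x)) => ->; case: (F2_cases (dot v y)) => ->.
Qed.

Lemma chi_perp1 v x : chi v x = if x \in perp [set v] then 1 else -1.
Proof. by rewrite /chi mem_perp1. Qed.

(** * The Fourier transform of an indicator function *)

Definition fhat B v : int := \sum_(x in B) chi v x.

Lemma fhat2 B : \sum_v fhat B v ^+ 2 = (2 ^ n * #|B|)%N%:R.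
Proof.
under eq_bigr => v _.
  rewrite expr2 /fhat big_distrlr /=.
  under eq_bigr => x _ do under eq_bigr => y _ do rewrite -chiD chiC.
  over.
rewrite exchange_big /= mulnC natrM mulr_natl -sumr_const.
apply: eq_bigr => x Bx.
rewrite exchange_big /=; under eq_bigr => y _ do rewrite chi_sum.
rewrite (bigD1 x) //= addrr_F2 eqxx big1 ?addr0 // => y /andP[_ yx].
case: ifP => // /eqP E; case/eqP: yx.
by rewrite -[y](@addKr2 _ (@addrr_F2 n) x) E addr0.
Qed.

(** Summing [chi v (x + y + z)] over all v selects the triples in B with
    x + y + z = 0, which are the Schur triples. *)
Lemma fhat3 B : \sum_v fhat B v ^+ 3 = (2 ^ n * ST B)%N%:R.
Proof.
have cube v : fhat B v ^+ 3 =
    \sum_(x in B) \sum_(y in B) \sum_(z in B) chi (x + y + z) v.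
  rewrite exprSr expr2 /fhat big_distrlr /= mulr_suml.
  apply: eq_bigr => x _; rewrite mulr_suml; apply: eq_bigr => y _.
  by rewrite mulr_sumr; apply: eq_bigr => z _; rewrite -!chiD chiC.
under eq_bigr => v _ do rewrite cube.
rewrite ST_tri /tri mulnC natrM natr_sum mulr_suml.
rewrite exchange_big /=; apply: eq_bigr => x Bx.
rewrite natr_sum mulr_suml.
rewrite exchange_big /=; apply: eq_bigr => y By.
rewrite exchange_big /=; under eq_bigr => z _ do rewrite chi_sum.
have E z : (x + y + z == 0) = (z == x + y).
  rewrite addrC addr_eq0; congr (_ == _); apply/eqP.
  by rewrite eq_sym -subr_eq0 opprK addrr_F2.
under eq_bigr => z _ do rewrite E.
rewrite -big_mkcondr /=; case: (boolP (x + y \in B)) => xyB.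
  rewrite (big_pred1 (x + y)) ?mul1r // => z /=.
  by case: eqP => [->|]; rewrite ?xyB ?andbF.
rewrite big1 ?mul0r // => z /andP[Bz /eqP zE].
by rewrite zE (negPf xyB) in Bz.
Qed.

Lemma card_perp_exp B : exists2 w, (w <= n)%N & #|perp B| = (2 ^ w)%N.
Proof.
by apply/dvdn_pfactor => //; rewrite -(card_perp [group of perp B]) dvdn_mulr.
Qed.

(** The hypothesis says that the span of B, which is its double annihilator,
    has order at most 2 ^ j.  Shrinking the annihilator of B to a subgroup L of
    order 2 ^ (n - j) enlarges the double annihilator to order exactly 2 ^ j. *)
Lemma subgroup_of_small_span B j :
  (j <= n)%N -> (2 ^ n <= 2 ^ j * #|perp B|)%N ->
  exists K : {group V}, #|K| = (2 ^ j)%N /\ B \subset K.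
Proof.
move=> jn big; have [w wn Wc] := card_perp_exp B.
have [] := @normal_pgroup 2 _ (n - j) [group of perp B] [group of perp B].
- by rewrite /pgroup Wc pnatX.
- exact: normal_refl.
- rewrite /= Wc pfactorK //; move: big; rewrite Wc -expnD leq_exp2l //; lia.
move=> L [LW _ Lc]; exists [group of perp L]; split => /=.
  apply/eqP; rewrite -(eqn_pmul2l (cardG_gt0 L)) card_perp Lc -expnD subnK //.
apply/subsetP => x Bx; apply/perpP => y /(subsetP LW) /perpP yB.
by rewrite dotC yB.
Qed.

Lemma fhatE B v :
  fhat B v = #|B :&: perp [set v]|%:Z - #|B :\: perp [set v]|%:Z.
Proof.
rewrite /fhat (big_setID (perp [set v])) /=; congr (_ + _).
  rewrite (eq_bigr (fun=> 1)); first by rewrite sumr_const natz.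
  by move=> x /setIP[_ xH]; rewrite chi_perp1 xH.
rewrite (eq_bigr (fun=> -1)); first by rewrite sumrN sumr_const natz.
by move=> x /setDP[_ /negPf xH]; rewrite chi_perp1 xH.
Qed.

Lemma fhat_perp B v : v \in perp B -> fhat B v = #|B|%:Z.
Proof.
move=> /perpP vB; rewrite -[RHS]natz -sumr_const; apply: eq_bigr => x Bx.
by rewrite /chi vB.
Qed.

(** The coefficient of B equals #|B| on the annihilator of B.  Elsewhere its
    cube is at most t / 4 times its square, and the total of the squares is
    known.  Since B spans a space of order at least 2t, the annihilator is small enough
    for the resulting bound to be strict. *)
Lemma ST_fourier B (t : nat) :
  (t < 2 * #|B|)%N -> (#|B| <= t)%N -> (2 * t * #|perp B| <= 2 ^ n)%N ->
  (forall v, v \notin perp B -> 4 * fhat B v <= t%:Z) ->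
  (ST B + 3 * t * #|B| < t ^ 2 + 3 * #|B| ^ 2)%N.
Proof.
move=> tb bt wN small.
set N := (2 ^ n)%N in wN; set w := #|perp B| in wN; set b := #|B| in tb bt *.
have N0 : (0 < N)%N by rewrite expn_gt0.
have le4 : 4 * (N * ST B)%N%:Z <=
    4 * w%:Z * b%:Z ^+ 3 + t%:Z * ((N * b)%N%:Z - w%:Z * b%:Z ^+ 2).
  have := fhat3 B; have := fhat2 B; rewrite !natz -/N -/b => <- <-.
  rewrite (bigID (mem (perp B))) /=.
  rewrite [\sum_v fhat B v ^+ 2](bigID (mem (perp B))) /=.
  have cst k : \sum_(v in perp B) fhat B v ^+ k = w%:Z * b%:Z ^+ k.
    rewrite -natz mulr_natl -sumr_const; apply: eq_bigr => v vB.
    by rewrite fhat_perp.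
  rewrite !cst mulrDr mulrA [X in t%:Z * X]addrAC subrr add0r lerD2l !mulr_sumr.
  apply: ler_sum => v /small le; rewrite exprS mulrA ler_wpM2r ?sqr_ge0 //.
rewrite -ltz_nat -!mulnn !PoszD !PoszM -!expr2.
move: le4; rewrite !PoszM.
move: wN; rewrite -lez_nat !PoszM.
move: tb bt N0; rewrite -!ltz_nat -lez_nat !PoszM.
exact: fourier_arith.
Qed.

(** Induction on #|B| + j: the bound for B and 2 ^ j follows from the bound for
    B and 2 ^ j.-1, or from the bound for the part of B in a hyperplane, which
    is smaller than B, and 2 ^ j or 2 ^ j.-1. *)
Lemma ST_max j B : (j <= n)%N -> (#|B| <= 2 ^ j)%N ->
  (ST B + 3 * 2 ^ j * #|B| <= (2 ^ j) ^ 2 + 3 * #|B| ^ 2)%N /\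
  ((2 ^ j < 2 * #|B|)%N ->
   (ST B + 3 * 2 ^ j * #|B| = (2 ^ j) ^ 2 + 3 * #|B| ^ 2)%N ->
   exists K : {group V}, #|K| = (2 ^ j)%N /\ B \subset K).
Proof.
have addxx := @addrr_F2 n.
have [m] := ubnP (#|B| + j); elim: m B j => // m IH B j mP jn Bj.
have [B2|B2] := leqP (2 * #|B|) (2 ^ j).
  split=> //; case: j => [|j] in mP jn Bj B2 *.
    have B0 : #|B| = 0%N by move: B2; rewrite expn0; lia.
    have := tri_le B B B; rewrite ST_tri B0; lia.
  have B2' : (#|B| <= 2 ^ j)%N by move: B2; rewrite expnS; lia.
  have [| |le _] := IH B j _ _ B2'; [lia | lia |].
  by rewrite [(2 ^ j.+1)%N]expnS; apply: quad_double.
(* B spans a space of order at most 2 ^ j. *)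
have [big|small] := leqP (2 ^ n) (2 ^ j * #|perp B|).
  have [K [Kc BK]] := subgroup_of_small_span jn big.
  split; last by exists K.
  by rewrite -Kc -(ST_compl addxx BK) leq_add2r leq_addr.
have Bn0 : (0 < #|B|)%N by lia.
have wN : (2 * 2 ^ j * #|perp B| <= 2 ^ n)%N.
  have [w wn Wc] := card_perp_exp B.
  by move: small; rewrite Wc -expnS -!expnD ltn_exp2l // leq_exp2l.
(* The threshold on the second part is exactly what makes all the Fourier
   coefficients small when no v qualifies. *)
have [/existsP[v /andP[vB vP]]|none] := boolP [exists v, (v \notin perp B) &&
    ((2 ^ j <= 2 * #|B :&: perp [set v]|)
     || (4 * #|B :\: perp [set v]| < 2 ^ j))%N]; last first.
  have lt : (ST B + 3 * 2 ^ j * #|B| < (2 ^ j) ^ 2 + 3 * #|B| ^ 2)%N.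
    apply: ST_fourier => // v vB.
    move: none; rewrite negb_exists => /forallP/(_ v).
    rewrite vB /= negb_or -ltnNge -leqNgt fhatE => /andP[].
    by move: #|_ :&: _| #|_ :\: _| (2 ^ j)%N => b0 b1 t; lia.
  by split=> [|_ E]; [exact: ltnW | move: lt; rewrite E ltnn].
have sE := ST_split addxx B (sum_mem_perp1 v).
have bE := esym (cardsID (perp [set v]) B).
have T1 :=
  tri_le (B :\: perp [set v]) (B :\: perp [set v]) (B :&: perp [set v]).
have b1 : (0 < #|B :\: perp [set v]|)%N.
  rewrite card_gt0; apply: contraNneq vB => B1e; apply/perpP => x Bx.
  have : x \in perp [set v].
    by apply: contraT => xH; rewrite -(in_set0 x) -B1e inE xH.
  by rewrite dotC => /perpP -> //; rewrite set11.
have B0H : {in B :&: perp [set v], forall x, x \in perp [set v]}.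
  by move=> x /setIP[].
have B1H : {in B :\: perp [set v], forall x, x \notin perp [set v]}.
  by move=> x /setDP[].
have B01 x : x \in B ->
    (x \in B :&: perp [set v]) || (x \in B :\: perp [set v]).
  by move=> Bx; rewrite !inE Bx !andbT orbN.
move: vP sE bE T1 b1 B0H B1H B01.
set B0 := B :&: perp [set v]; set B1 := B :\: perp [set v].
move=> vP sE bE T1 b1 B0H B1H B01.
have [half|half] := leqP (2 ^ j) (2 * #|B0|); last first.
  have {vP}quarter : (4 * #|B1| < 2 ^ j)%N by case/orP: vP => //; lia.
  case: j => [|j] in IH mP jn Bj B2 small wN half quarter *.
    by move: quarter half; rewrite expn0; lia.
  rewrite expnS in half quarter.
  have [| | |le _] := IH B0 j; [lia | lia | lia |].
  suff lt : (ST B + 3 * 2 ^ j.+1 * #|B| < (2 ^ j.+1) ^ 2 + 3 * #|B| ^ 2)%N.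
    by split=> [|_ E]; [exact: ltnW | move: lt; rewrite E ltnn].
  rewrite sE bE [(2 ^ j.+1)%N]expnS; apply: quad_small_half => //; lia.
have [| | |le _] := IH B0 j; [lia | lia | lia |].
rewrite sE bE; split=> [|_ E]; first exact: quad_large_half.
(* Equality: B0 has t / 2 elements and t^2 / 4 Schur triples, so it is closed
   under addition, and the sums of two elements of B1 all lie in B0. *)
have [tE rE sE0] := quad_large_half_eq half T1 b1 le E.
have /set0Pn[y B1y] : B1 != set0 by rewrite -card_gt0.
have B0add : {in B0 &, forall x z, x + z \in B0}.
  by apply: tri_eq_full; rewrite -ST_tri.
have B0n0 : B0 != set0 by rewrite -card_gt0; have := expn_gt0 2 j; lia.
have [|K [Kc KP]] := add_closed_coset addxx B0n0 B0add (_ : y \notin B0).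
  by apply: contra (B1H y B1y) => /B0H.
exists K; split; first by rewrite Kc tE.
apply/subsetP => x /B01; rewrite KP => /orP[-> //|B1x].
by rewrite (tri_eq_full rE) ?orbT.
Qed.

End VectorSpace.

(** * The sets of binary representations *)

Lemma digits_inj N m m' : (m < 2 ^ N)%N -> (m' < 2 ^ N)%N ->
  (forall i, (i < N)%N -> (m %/ 2 ^ i) %% 2 = (m' %/ 2 ^ i) %% 2)%N -> m = m'.
Proof.
elim: N m m' => [|N IH] m m'; first by rewrite expn0; case: m m' => [|m] [|m'].
rewrite expnS => mN mN' H; have := H 0%N isT; rewrite expn0 !divn1 => par.
rewrite (divn_eq m 2) (divn_eq m' 2) par; congr (_ * 2 + _)%N.
apply: IH => [||i iN]; rewrite ?ltn_divLR // 1?mulnC //.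
by rewrite -!divnMA -expnS H.
Qed.

Lemma F2_natr_inj c c' :
  (c < 2)%N -> (c' < 2)%N -> c%:R = c'%:R :> 'F_2 -> c = c'.
Proof. by case: c c' => [|[|c]] [|[|c']]. Qed.

Lemma binary_rep_digit n m d (dn : (d < n)%N) :
  binary_rep n m 0 (rev_ord (Ordinal dn)) = ((m %/ 2 ^ d) %% 2)%N%:R.
Proof. by rewrite mxE /= (_ : (n - (n - d.+1).+1)%N = d) //; lia. Qed.

Lemma binary_rep_inj n : injective (fun m : 'I_(2 ^ n) => binary_rep n m).
Proof.
move=> m m' E; apply/val_inj/(digits_inj (ltn_ord m) (ltn_ord m')) => d dn.
by apply: F2_natr_inj; rewrite ?ltn_mod // -!(binary_rep_digit _ dn) E.
Qed.

Definition low_set n b : {set 'rV['F_2]_n} :=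
  [set binary_rep n m | m : 'I_(2 ^ n) & (m < b)%N].

Lemma card_low_set n b : (b <= 2 ^ n)%N -> #|low_set n b| = b.
Proof.
move=> bn; rewrite card_imset; last exact: binary_rep_inj.
rewrite -sum1_card (eq_bigl (fun m : 'I_(2 ^ n) => (m < b)%N)); last first.
  by move=> m; rewrite inE.
by rewrite (big_ord_narrow bn) sum_nat_const card_ord muln1.
Qed.

Lemma binary_repP n (x : 'rV['F_2]_n) :
  exists m : 'I_(2 ^ n), x = binary_rep n m.
Proof.
have [|g _ gK] := inj_card_bij (@binary_rep_inj n).
  by rewrite card_mx card_Fp // mul1n card_ord.
by exists (g x); rewrite gK.
Qed.

Lemma mem_low_set n b (m : 'I_(2 ^ n)) :
  (binary_rep n m \in low_set n b) = (m < b)%N.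
Proof.
apply/imsetP/idP => [[m' mb /binary_rep_inj ->]|mb]; first by rewrite inE in mb.
by exists m; rewrite ?inE.
Qed.

Lemma top_setE n a : top_set n a = ~: low_set n (2 ^ n - a).
Proof.
apply/setP => x; have [m ->] := binary_repP x; rewrite inE mem_low_set -leqNgt.
apply/imsetP/idP => [[m' mb /binary_rep_inj ->]|mb]; first by rewrite inE in mb.
by exists m; rewrite ?inE.
Qed.

Lemma mem_low_set_exp n k (x : 'rV['F_2]_n) : (k <= n)%N ->
  reflect (forall i : 'I_n, (i < n - k)%N -> x 0 i = 0)
          (x \in low_set n (2 ^ k)).
Proof.
move=> kn; apply: (iffP idP).
  have [m ->] := binary_repP x; rewrite mem_low_set => mk i ik.
  by rewrite mxE divn_small // (leq_trans mk) // leq_exp2l //; lia.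
have [m ->] := binary_repP x; rewrite mem_low_set => H.
suff : (m %/ 2 ^ k = 0)%N.
  by move/eqP; rewrite -leqn0 -ltnS ltn_divLR ?expn_gt0 // mul1n.
apply: (@digits_inj (n - k)) => [||d dk]; rewrite ?expn_gt0 //.
  by rewrite ltn_divLR ?expn_gt0 // -expnD subnK.
have dn : (k + d < n)%N by lia.
apply: F2_natr_inj; rewrite ?ltn_mod // -divnMA -expnD div0n mod0n.
by rewrite -(binary_rep_digit _ dn) H //=; lia.
Qed.

Lemma low_set_group_set n k : (k <= n)%N -> group_set (low_set n (2 ^ k)).
Proof.
move=> kn; apply/group_setP; split=> [|x y].
  by apply/mem_low_set_exp => // i _; rewrite mxE.
move=> /mem_low_set_exp xk /mem_low_set_exp yk.
apply/mem_low_set_exp => // i ik.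
by rewrite mxE xk ?yk ?addr0.
Qed.

(** The numbers in [b, 2 ^ k) all have digit 1 at 2 ^ (k - 1), so the sum of
    two of them has digit 0 there. *)
Lemma low_set_top_sum_free n k b : (k <= n)%N -> (2 ^ k < 2 * b)%N ->
  sum_free (low_set n (2 ^ k) :\: low_set n b).
Proof.
case: k => [|k] kn kb.
  (* Here b >= 1, so the set is empty. *)
  move=> x y z; have [m ->] := binary_repP x; rewrite inE !mem_low_set.
  by rewrite expn0 in kb *; lia.
have top x : x \in low_set n (2 ^ k.+1) :\: low_set n b ->
    x 0 (rev_ord (Ordinal kn)) = 1.
  have [m ->] := binary_repP x; rewrite inE !mem_low_set -leqNgt.
  move=> /andP[bm mk].
  rewrite binary_rep_digit; suff -> : (m %/ 2 ^ k = 1)%N by [].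
  apply/eqP; rewrite eqn_leq -ltnS ltn_divLR ?expn_gt0 // -expnS mk /=.
  by rewrite leq_divRL ?expn_gt0 // mul1n; move: kb; rewrite expnS; lia.
move=> x y z /top x1 /top y1 /top z1 /rowP/(_ (rev_ord (Ordinal kn))).
by rewrite mxE x1 y1 z1.
Qed.

Lemma ST_low_set n k b : (k <= n)%N -> (b <= 2 ^ k)%N -> (2 ^ k < 2 * b)%N ->
  (ST (low_set n b) + 3 * 2 ^ k * b = (2 ^ k) ^ 2 + 3 * b ^ 2)%N.
Proof.
move=> kn bk kb; have kN : (2 ^ k <= 2 ^ n)%N by rewrite leq_exp2l.
have := @ST_compl _ (@addrr_F2 n) (Group (low_set_group_set kn)) (low_set n b).
rewrite /= (proj1 (sum_freeP _) (low_set_top_sum_free kn kb)) addn0.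
rewrite !card_low_set // ?(leq_trans bk) //; apply.
apply/subsetP => x; have [m ->] := binary_repP x; rewrite !mem_low_set => mb.
exact: leq_trans bk.
Qed.

(** The exponent is nonnegative because 1 <= 2 ^ n - a <= 2 ^ k. *)
Lemma exponent_nat n a (k : int) : (1 <= a <= 2 ^ n - 1)%N ->
  2 ^+ n - 2 ^ k <= a%:R :> rat -> a%:R < 2 ^+ n - 2 ^ (k - 1) :> rat ->
  exists j : nat, [/\ k = j, (j <= n)%N, (2 ^ n - a <= 2 ^ j)%N
    & (2 ^ j < 2 * (2 ^ n - a))%N].
Proof.
move=> /andP[a1 aN] hk hk1; have N0 : (0 < 2 ^ n)%N by rewrite expn_gt0.
have bE : 2 ^+ n - a%:R = (2 ^ n - a)%N%:R :> rat.
  by rewrite natrB ?natrX //; lia.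
have {}hk : (2 ^ n - a)%N%:R <= 2 ^ k :> rat by rewrite -bE lerBlDr -lerBlDl.
have {}hk1 : 2 ^ (k - 1) < (2 ^ n - a)%N%:R :> rat.
  by rewrite -bE ltrBrDr -ltrBrDl.
case: k hk hk1 => j hk hk1; last first.
  have : 1 <= 2 ^ Negz j :> rat by apply: le_trans hk; rewrite ler1n; lia.
  by rewrite NegzE -exprnN invf_ge1 ?exprn_gt0 // leNgt exprn_egt1.
have jE : (2 ^ j < 2 * (2 ^ n - a))%N.
  rewrite -(ltr_nat rat) natrM natrX -ltr_pdivrMl // mulrC.
  by rewrite expfzDr // expr1z in hk1 *.
exists j; split=> //.
  by rewrite -ltnS -(ltn_exp2l _ _ (isT : 1 < 2)%N) expnS; lia.
by rewrite -(ler_nat rat) natrX.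
Qed.

Theorem mainTheorem5 (n a : nat) (k : int)
    (hn : (0 < n)%N) (ha : (1 <= a <= 2 ^ n - 1)%N)
    (hk : 2 ^+ n - 2 ^ k <= a%:R :> rat)
    (hk1 : a%:R < 2 ^+ n - 2 ^ (k - 1) :> rat)
    (A : {set 'rV['F_2]_n}) (hA : #|A| = a) :
  ST A = ST (top_set n a) <->
  exists K : {group 'rV['F_2]_n},
    [/\ #|K|%:R = 2 ^ k :> rat, ~: K \subset A & sum_free (A :&: K)].
Proof.
have [j [-> jn bj jb]] := exponent_nat ha hk hk1.
set b := (2 ^ n - a)%N in bj jb.
have bn : (b <= 2 ^ n)%N by exact: leq_subr.
have addxx := @addrr_F2 n.
have cV : #|[set: 'rV['F_2]_n]| = (2 ^ n)%N.
  by rewrite cardsT card_mx card_Fp // mul1n.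
have Bb : #|~: A| = b by rewrite cardsCs setCK hA /b -cV cardsT.
have compl (B : {set 'rV['F_2]_n}) : #|B| = b ->
    (ST B + ST (~: B) + 3 * 2 ^ n * b = (2 ^ n) ^ 2 + 3 * b ^ 2)%N.
  have := ST_compl addxx (subsetT B : B \subset [group of setT]).
  by rewrite /= setTD cV => + <-.
have cA := compl _ Bb; rewrite setCK in cA.
have cL := compl _ (card_low_set bn); rewrite -top_setE in cL.
have lowE := ST_low_set jn bj jb.
have STE : ST A = ST (top_set n a) <->
    (ST (~: A) + 3 * 2 ^ j * b = (2 ^ j) ^ 2 + 3 * b ^ 2)%N by split; lia.
have KE (K : {group 'rV['F_2]_n}) : A :&: K = K :\: ~: A.
  by rewrite setDE setCK setIC.
apply: iff_trans STE _; split=> [E|[K [Kc KA fK]]].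
  have := ST_max jn (_ : #|~: A| <= 2 ^ j)%N.
  rewrite Bb => /(_ bj)[_ /(_ jb E)[K [Kc AK]]].
  exists K; split; first by rewrite Kc natrX.
    by rewrite -setCS setCK.
  rewrite KE; apply/sum_freeP; have := ST_compl addxx AK; rewrite Kc Bb.
  by move/eqP; rewrite -E addnAC -[eqbRHS]addn0 eqn_add2l => /eqP.
have {}Kc : #|K| = (2 ^ j)%N by apply/eqP; rewrite -(eqr_nat rat) Kc natrX.
have AK : ~: A \subset K by rewrite -setCS setCK.
by have := ST_compl addxx AK; rewrite -KE (proj1 (sum_freeP _) fK) addn0 Kc Bb.
Qed.
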